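(* Let $(X,\mu)$ be a standard probability space and $R$ a countable Borel measure-preserving equivalence relation on $X$. (a) If $R$ is sofic and $A\subseteq X$ is any non-null Borel subset, then $R|_A$ is sofic. (b) If $\{A_n\}$ is a countable Borel partition of $X$ by non-null $R$-invariant subsets, then $R$ is sofic if and only if each $R|_{A_n}$ is sofic.
   Context: A standard probability space $(X,\mu)$ is a standard Borel space with a Borel probability measure. A countable Borel equivalence relation $R$ on $X$ is an equivalence relation that is Borel in $X\times X$ with all classes countable. $[[R]]_B$ is the set of Borel isomorphisms $g:\operatorname{dom}g\to\operatorname{ran}g$ between Borel subsets of $X$ with $(x,gx)\in R$ for all $x\in\operatorname{dom}g$; it is an inverse monoid under composition of partial maps. $R$ is measure-preserving if $\mu(g(A))=\mu(A)$ for all $g\in[[R]]_B$ and Borel $A\subseteq\operatorname{dom}g$. The full semigroup $[[R]]$ is the quotient of $[[R]]_B$ by the pseudometric $d_\mu(g,h)=\mu(\operatorname{dom}g\triangle\operatorname{dom}h)+\mu\{x\in\operatorname{dom}g\cap\operatorname{dom}h:gx\ne hx\}$. For $N\in\mathbb{N}$, $[N]=\{0,\dots,N-1\}$ carries normalized counting measure $\mu_\#$, $[[N]]$ is the set of all partial bijections of $[N]$, and $d_\#$ is the analogous metric on $[[N]]$ defined with $\mu_\#$. $R$ (on $(X,\mu)$) is sofic if for each finite $K\subseteq[[R]]$ and $\epsilon>0$ there exist $N\in\mathbb{N}$ and $\pi:[[R]]\to[[N]]$ with: (i) $\pi(\operatorname{id}_X)=1_{[N]}$ and $\pi(\varnothing)=\varnothing$;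 (ii) $d_\#(\pi(\varphi\psi),\pi(\varphi)\pi(\psi))<\epsilon$ for all $\varphi,\psi\in K$; (iii) $|\mu\{x:\varphi(x)=x\}-\mu_\#\{m:\pi(\varphi)(m)=m\}|<\epsilon$ for all $\varphi\in K$. For a non-null Borel $A\subseteq X$, $R|_A=R\cap(A\times A)$ is considered as a relation on $(A,\mu_A)$, where $\mu_A(B)=\mu(B)/\mu(A)$ for $B\subseteq A$. A set is $R$-invariant if it is a union of $R$-classes. *)

(* Defs.v *)
From HB Require Import structures.
From mathcomp Require Import all_boot all_order all_algebra.
From mathcomp Require Import all_classical all_reals all_analysis.

Set Implicit Arguments.
Unset Strict Implicit.
Unset Printing Implicit Defensive.

Import Order.TTheory GRing.Theory Num.Theory.

Local Open Scope classical_set_scope.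
Local Open Scope ring_scope.

Definition polish (R : realType) (P : metricType R) : Prop :=
  (exists2 S : set P, countable S & dense S) /\
  (forall F : set_system P, ProperFilter F -> cauchy F ->
    exists x : P, F --> x).

Definition standard_borel (R : realType) d (T : measurableType d) : Prop :=
  exists (P : metricType R) (f : T -> P),
    [/\ polish P, bijective f
      & forall A : set T, measurable A <-> <<s [set B : set P | open B] >> (f @` A)].

(* A partial map from T to U is a function T -> option U, undefined at the
   points sent to None; composition is ssrfun's pcomp. *)
Section partial_maps.
Variables T U : Type.
Implicit Types f g : T -> option U.

Definition pdom f : set T := [set x | f x <> None].

Definition pimage f (A : set T) : set U :=
  [set y | exists2 x, A x & f x = Some y].

Definition ppreimage f (B : set U) : set T :=
  [set x | exists2 y, B y & f x = Some y].

Definition partial_injective f : Prop :=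
  forall x y z, f x = Some z -> f y = Some z -> x = y.

End partial_maps.

Lemma partial_injective_comp T U V (f : U -> option V) (g : T -> option U) :
  partial_injective f -> partial_injective g -> partial_injective (pcomp f g).
Proof.
move=> fi gi x y z; rewrite /pcomp.
case gx : (g x) => [u|//]; case gy : (g y) => [v|//] /= fu fv.
by apply: gi gx _; rewrite gy (fi _ _ _ fu fv).
Qed.

Record cber d (T : measurableType d) := CBER {
  cber_rel :> T -> T -> Prop ;
  cber_measurable : measurable [set xy : T * T | cber_rel xy.1 xy.2] ;
  cber_refl : forall x, cber_rel x x ;
  cber_sym : forall x y, cber_rel x y -> cber_rel y x ;
  cber_trans : forall x y z, cber_rel x y -> cber_rel y z -> cber_rel x z ;
  cber_countable : forall x, countable [set y | cber_rel x y] }.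

(* A union of E-classes. *)
Definition invariant_set d (T : measurableType d) (E : cber T) (A : set T) :=
  exists S : set T, A = \bigcup_(x in S) [set y | E x y].

(* [[E]]_B. The last two fields, applied to setT, say that the domain and the
   range are Borel; in general they say that the map and its inverse are. *)
Record borel_piso d (T : measurableType d) (E : cber T) := PartialIso {
  piso_fun :> T -> option T ;
  piso_inj : partial_injective piso_fun ;
  piso_rel : forall x y, piso_fun x = Some y -> E x y ;
  piso_ppreimage : forall B, measurable B -> measurable (ppreimage piso_fun B) ;
  piso_pimage : forall A, measurable A -> measurable (pimage piso_fun A) }.

Section borel_piso_ops.
Context d (T : measurableType d) (E : cber T).

Lemma piso_id_rel x y : (@Some T) x = Some y -> E x y.
Proof. by case=> <-; exact: cber_refl. Qed.

Lemma piso_id_inj : partial_injective (@Some T).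
Proof. by move=> x y z [->] [->]. Qed.

Lemma piso_id_ppreimage (B : set T) :
  measurable B -> measurable (ppreimage (@Some T) B).
Proof.
rewrite (_ : ppreimage _ _ = B) //.
by apply/seteqP; split=> [x [y By [->]]|x Bx] //; exists x.
Qed.

Lemma piso_id_pimage (A : set T) :
  measurable A -> measurable (pimage (@Some T) A).
Proof.
rewrite (_ : pimage _ _ = A) //.
by apply/seteqP; split=> [x [y Ay [<-]]|x Ax] //; exists x.
Qed.

Definition piso_id : borel_piso E :=
  PartialIso piso_id_inj piso_id_rel piso_id_ppreimage piso_id_pimage.

Let empty (_ : T) : option T := None.

Lemma piso_empty_inj : partial_injective empty. Proof. by []. Qed.

Lemma piso_empty_rel x y : empty x = Some y -> E x y. Proof. by []. Qed.

Lemma piso_empty_ppreimage (B : set T) :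
  measurable B -> measurable (ppreimage empty B).
Proof.
move=> _; rewrite (_ : ppreimage _ _ = set0) //.
by apply/seteqP; split=> // x [].
Qed.

Lemma piso_empty_pimage (A : set T) :
  measurable A -> measurable (pimage empty A).
Proof.
move=> _; rewrite (_ : pimage _ _ = set0) //.
by apply/seteqP; split=> // x [].
Qed.

Definition piso_empty : borel_piso E :=
  PartialIso piso_empty_inj piso_empty_rel piso_empty_ppreimage
    piso_empty_pimage.

Section comp.
Variables g h : borel_piso E.

Lemma piso_comp_inj : partial_injective (pcomp g h).
Proof. by apply: partial_injective_comp; exact: piso_inj. Qed.

Lemma piso_comp_rel x y : pcomp g h x = Some y -> E x y.
Proof.
rewrite /pcomp; case hx : (h x) => [u|//] /= gu.
exact: cber_trans (piso_rel hx) (piso_rel gu).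
Qed.

Lemma piso_comp_ppreimage (B : set T) :
  measurable B -> measurable (ppreimage (pcomp g h) B).
Proof.
move=> mB.
rewrite (_ : ppreimage _ _ = ppreimage h (ppreimage g B)); last first.
  apply/seteqP; rewrite /pcomp; split=> x.
    by move=> [z Bz]; case hx : (h x) => [y|//] /= gy; exists y => //; exists z.
  by move=> [y [z Bz gy] hx]; exists z => //; rewrite hx.
exact/piso_ppreimage/piso_ppreimage.
Qed.

Lemma piso_comp_pimage (A : set T) :
  measurable A -> measurable (pimage (pcomp g h) A).
Proof.
move=> mA.
rewrite (_ : pimage _ _ = pimage g (pimage h A)); last first.
  apply/seteqP; rewrite /pcomp; split=> z.
    by move=> [x Ax]; case hx : (h x) => [y|//] /= gy; exists y => //; exists x.
  by move=> [y [x Ax hx] gy]; exists x => //; rewrite hx.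
exact/piso_pimage/piso_pimage.
Qed.

Definition piso_comp : borel_piso E :=
  PartialIso piso_comp_inj piso_comp_rel piso_comp_ppreimage piso_comp_pimage.

End comp.
End borel_piso_ops.

Section full_semigroup.
Context d (T : measurableType d) (R : realType).
Variables (mu : probability T R) (E : cber T).
Local Open Scope ereal_scope.

Definition measure_preserving : Prop :=
  forall (g : borel_piso E) (A : set T),
    measurable A -> A `<=` pdom g -> mu (pimage g A) = mu A.

Definition piso_dist (g h : borel_piso E) : \bar R :=
  mu (pdom g `+` pdom h) + mu [set x | (pdom g `&` pdom h) x /\ g x <> h x].

(* [[E]]: the quotient, as the set of classes. *)
Definition full_semigroup : Type :=
  {C : set (borel_piso E) | exists g, C = [set h | piso_dist g h = 0]}.

Definition piso_class (g : borel_piso E) : full_semigroup :=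
  exist _ [set h | piso_dist g h = 0] (ex_intro _ g erefl).

End full_semigroup.

(* [[N]] *)
Record pbij (N : nat) := PBij {
  pbij_fun :> {ffun 'I_N -> option 'I_N} ;
  pbij_inj : partial_injective pbij_fun }.

Section pbij_ops.
Variable N : nat.

Lemma pbij_id_inj : partial_injective [ffun x : 'I_N => Some x].
Proof. by move=> x y z; rewrite !ffunE => -[->] [->]. Qed.

Definition pbij_id : pbij N := PBij pbij_id_inj.

Lemma pbij_empty_inj : partial_injective [ffun _ : 'I_N => None : option 'I_N].
Proof. by move=> x y z; rewrite ffunE. Qed.

Definition pbij_empty : pbij N := PBij pbij_empty_inj.

Lemma pbij_comp_inj (f g : pbij N) : partial_injective (finfun (pcomp f g)).
Proof.
move=> x y z; rewrite !ffunE.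
by apply: partial_injective_comp; exact: pbij_inj.
Qed.

Definition pbij_comp (f g : pbij N) : pbij N := PBij (@pbij_comp_inj f g).

Variable R : realType.

Definition mu_count (A : pred 'I_N) : R := #|A|%:R / N%:R.

Definition pbij_dist (f g : pbij N) : R :=
  mu_count [pred x | isSome (f x) (+) isSome (g x)] +
  mu_count [pred x | [&& isSome (f x), isSome (g x) & f x != g x]].

End pbij_ops.

(* The product and the fixed-point set of elements of [[E]] are taken on
   arbitrary representatives: when mu is preserved by E and T is standard Borel,
   representatives at piso_dist 0 have products at piso_dist 0 and fixed-point
   sets of equal measure. The condition 0 < N is needed for mu_count to be a
   probability. *)
Definition sofic d (T : measurableType d) (R : realType)
    (mu : probability T R) (E : cber T) : Prop :=
  forall (K : set (full_semigroup mu E)) (eps : R),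
    finite_set K -> 0 < eps ->
  exists (N : nat) (pi : full_semigroup mu E -> pbij N),
    [/\ (0 < N)%N,
        pi (piso_class mu (piso_id E)) = pbij_id N /\
        pi (piso_class mu (piso_empty E)) = pbij_empty N,
        (forall g h : borel_piso E,
          K (piso_class mu g) -> K (piso_class mu h) ->
          pbij_dist R (pi (piso_class mu (piso_comp g h)))
            (pbij_comp (pi (piso_class mu g)) (pi (piso_class mu h))) < eps)
      & (forall g : borel_piso E, K (piso_class mu g) ->
          `|fine (mu [set x | g x = Some x])
            - mu_count R [pred m | pi (piso_class mu g) m == Some m]| < eps)].

Record nonnull d (T : measurableType d) (R : realType)
    (mu : probability T R) := NonNull {
  nonnull_set :> set T ;
  nonnull_measurable : measurable nonnull_set ;
  nonnull_neq0 : mu nonnull_set != 0%E }.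

(* The sigma-algebra of the subtype is the trace of that of T. Measurable types
   are pointed, hence the dependence on nonnull_neq0. *)
Section carrier.
Context d (T : measurableType d) (R : realType) (mu : probability T R).
Variable A : nonnull mu.

Definition carrier : Type := set_type A.

Lemma nonnull_nonempty : exists x, x \in nonnull_set A.
Proof.
have /set0P[x Ax] : nonnull_set A != set0.
  by apply: contraNneq (nonnull_neq0 A) => ->; rewrite measure0.
by exists x; rewrite inE.
Qed.

HB.instance Definition _ := gen_eqMixin carrier.
HB.instance Definition _ := gen_choiceMixin carrier.
HB.instance Definition _ := isPointed.Build carrier
  (exist _ _ (projT2 (cid nonnull_nonempty))).

Definition carrier_val (x : carrier) : T := sval x.

HB.instance Definition _ := Measurable.copy carrier
  (g_sigma_algebra_preimageType carrier_val).

Lemma carrier_val_inj : injective carrier_val.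
Proof. exact: val_inj. Qed.

Lemma measurable_carrier_val : measurable_fun setT carrier_val.
Proof. by move=> _ B mB; exists B. Qed.

Lemma measurable_carrier_val_image (B : set carrier) :
  measurable B -> measurable (carrier_val @` B).
Proof.
move=> [C mC <-]; rewrite setTI (_ : _ @` _ = C `&` nonnull_set A).
  exact: measurableI (nonnull_measurable A).
apply/seteqP; split=> [_ [x Cx <-]|x [Cx Ax]].
  by split=> //; have := svalP x; rewrite inE.
by exists (exist _ x (mem_set Ax)).
Qed.

Local Open Scope ereal_scope.

Definition cond_measure (B : set carrier) : \bar R :=
  mu (carrier_val @` B) * ((fine (mu A))^-1)%:E.

Let cond_measure0 : cond_measure set0 = 0.
Proof. by rewrite /cond_measure image_set0 measure0 mul0e. Qed.

Let cond_measure_ge0 B : 0 <= cond_measure B.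
Proof. by rewrite mule_ge0// lee_fin invr_ge0 fine_ge0. Qed.

Let cond_measure_sigma_additive : semi_sigma_additive cond_measure.
Proof.
move=> F mF tF mUF.
rewrite [X in X @ _ --> _](_ : _ =
    (fun n => \sum_(0 <= i < n) mu (carrier_val @` F i)) \*
    cst ((fine (mu A))^-1)%:E); last first.
  by apply/funext => n; rewrite -ge0_sume_distrl.
rewrite /cond_measure image_bigcup.
apply: cvgeZr => //; apply: measure_semi_sigma_additive.
- by move=> i; exact: measurable_carrier_val_image.
- apply/trivIsetP => i j _ _ ij.
  apply/seteqP; split=> // _ [[x Fx <-] [y Fy /carrier_val_inj yx]].
  have : (F i `&` F j) x by split=> //; rewrite -yx.
  by move/trivIsetP : tF => ->.
- by rewrite -image_bigcup; exact: measurable_carrier_val_image.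
Qed.

HB.instance Definition _ := isMeasure.Build _ _ _ cond_measure
  cond_measure0 cond_measure_ge0 cond_measure_sigma_additive.

Let cond_measureT : cond_measure setT = 1.
Proof.
rewrite /cond_measure (_ : _ @` _ = nonnull_set A); last first.
  apply/seteqP; split=> [_ [x _ <-]|x Ax].
    by have := svalP x; rewrite inE.
  by exists (exist _ x (mem_set Ax)).
have fA : mu A \is a fin_num.
  exact: fin_num_measure (nonnull_measurable A).
rewrite -{1}(fineK fA) -EFinM divff// fine_eq0//.
exact: nonnull_neq0.
Qed.

HB.instance Definition _ :=
  Measure_isProbability.Build _ _ _ cond_measure cond_measureT.

Definition cond_prob : probability carrier R := cond_measure.

End carrier.

Section restriction.
Context d (T : measurableType d) (R : realType) (mu : probability T R).
Variables (E : cber T) (A : nonnull mu).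

Definition restr_rel (x y : carrier A) : Prop := E (carrier_val x) (carrier_val y).

Lemma restr_rel_measurable :
  measurable [set xy : carrier A * carrier A | restr_rel xy.1 xy.2].
Proof.
have mf : measurable_fun setT
    (fun xy : carrier A * carrier A => (carrier_val xy.1, carrier_val xy.2)).
  apply/measurable_fun_pair => /=;
    by apply: measurableT_comp; first exact: measurable_carrier_val.
by have := mf measurableT _ (cber_measurable E); rewrite setTI.
Qed.

Lemma restr_rel_countable x : countable [set y | restr_rel x y].
Proof.
have /countable_injP[f fi] := cber_countable E (carrier_val x).
apply/countable_injP; exists (f \o @carrier_val _ _ _ _ A) => y z Ey Ez fyz.
apply/carrier_val_inj/(fi _ _ _ _ fyz); apply: mem_set;
  [exact: (set_mem Ey)|exact: (set_mem Ez)].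
Qed.

Definition restr_cber : cber (carrier A) :=
  CBER restr_rel_measurable
    (fun x => cber_refl E (carrier_val x))
    (fun x y => @cber_sym _ _ E (carrier_val x) (carrier_val y))
    (fun x y z => @cber_trans _ _ E (carrier_val x) (carrier_val y) (carrier_val z))
    restr_rel_countable.

End restriction.

(* Main.v *)
Require Import Defs.
From mathcomp Require Import all_boot all_order all_algebra.
From mathcomp Require Import all_classical all_reals all_analysis.
From mathcomp Require Import ring lra.

Set Implicit Arguments.
Unset Strict Implicit.
Unset Printing Implicit Defensive.

Import Order.TTheory GRing.Theory Num.Theory.

Local Open Scope classical_set_scope.
Local Open Scope ring_scope.

(** A sofic approximation is a map of the full semigroup into partial injections
    of a finite set that is almost multiplicative and almost preserves the
    measure of the fixed-point set. Two elements of the full semigroup are equal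
    when they differ on a null set, and the distance between partial injections
    of a finite set is the proportion of points at which they differ
    ([piso_distE], [pbij_distE]); so every estimate below consists in counting
    bad points.

    Passing to a subset [A] ([sofic_restr]). An element of the full semigroup of
    the restriction to [A] is extended to [X] by leaving it undefined off [A].
    The identity of [A] then becomes an idempotent [e] of measure [mu A], and an
    approximation [q] of the full semigroup of [X] sends [e] to a partial
    injection whose fixed points form a set [F] of proportion close to [mu A].
    The approximation on [A] is [q] cut down to [F]. Cutting down spoils a
    product [g h] only at points that [q h] moves out of [F]; since [e h = h],
    almost every value of [q h] is fixed by [q e], which is to say lies in [F].
    Dividing by the proportion of [F] on one side and by [mu A] on the other
    changes the fixed-point estimate little ([ratio_close]).

    Gluing invariant pieces ([sofic_of_invariant_pieces]). Restriction to an
    invariant set respects composition ([piso_restr_comp]), so each piece [A_i]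
    comes with an approximation of the restricted elements on a finite set
    [F_i]. Finitely many pieces carry almost all of the measure
    ([exhaust_pieces]), and on the disjoint union of [k_i] copies of [F_i] the
    proportions are averages of those on the [F_i] with weights proportional to
    [k_i * #|F_i|]; integers [k_i] can be chosen to make these weights close to
    the measures of the [A_i] ([integer_weights], [weighted_average_close]).

    An approximation is defined on classes modulo null sets. A map between
    partial isomorphisms that preserves almost-everywhere equality descends to
    classes ([class_mapE]). Equality almost everywhere makes sense because the
    set where two Borel maps differ is measurable, a standard Borel space having
    a countable family of Borel sets that separates its points
    ([standard_borel_separated]). *)

(** * Equality of partial isomorphisms almost everywhere *)

Definition countably_separated d (T : measurableType d) : Prop :=
  exists B : nat * nat -> set T,
    (forall i, measurable (B i)) /\
    (forall x y, (forall i, B i x -> B i y) -> x = y).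

Lemma metric_ball_open (R : realType) (P : metricType R) (x : P) (r : R) :
  open [set y | mdist x y < r].
Proof.
rewrite openE => y /= xy; apply/nbhs_ballP; exists (r - mdist x y) => /=.
  by rewrite subr_gt0.
rewrite ballEmdist => z /= yz; have := metric_triangle x y z; lra.
Qed.

(** The balls of radius [1/(m+1)] around the points of a countable dense set
    separate the points of a metric space. *)
Lemma standard_borel_separated (R : realType) d (T : measurableType d) :
  standard_borel R T -> countably_separated T.
Proof.
move=> [P [f [[[S /countable_injP[e einj] Sdense] _] bf mE]]].
have finj := bij_inj bf.
(* [e] numbers the dense set injectively, so this union is a ball or empty. *)
pose O (i : nat * nat) : set P :=
  \bigcup_(s in [set s | S s /\ e s = i.1]) [set y | mdist s y < i.2.+1%:R^-1].
have mO i : open (O i) by apply: bigcup_open => s _; exact: metric_ball_open.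
exists (fun i => f @^-1` O i); split=> [i|x y xy].
  apply/mE; rewrite image_preimage.
    by apply: sub_sigma_algebra; exact: mO.
  apply/seteqP; split=> // z _; have [g _ fg] := bf; by exists (g z).
apply: finj; apply: contrapT => /eqP; rewrite -mdist_gt0 => r0.
have r20 : 0 < mdist (f x) (f y) / 2 by rewrite divr_gt0.
have [m mr] := ltr_add_invr r20.
rewrite add0r in mr.
have m0 : 0 < m.+1%:R^-1 :> R by rewrite invr_gt0.
have [||s [/= xs Ss]] := Sdense [set z | mdist (f x) z < m.+1%:R^-1].
- by exists (f x) => /=; rewrite mdistxx.
- exact: metric_ball_open.
have /xy[t [St est]] : O (e s, m) (f x) by exists s => //=; rewrite metric_sym.
have -> : t = s by apply: einj => //; rewrite inE.
move=> /= sy.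
have : mdist (f x) (f y) <= mdist (f x) s + mdist s (f y).
  exact: metric_triangle.
by rewrite leNgt (lt_trans (ltrD xs sy))// [ltRHS]splitr ltrD.
Qed.

Lemma carrier_separated d (T : measurableType d) (R : realType)
    (mu : probability T R) (A : nonnull mu) :
  countably_separated T -> countably_separated (carrier A).
Proof.
move=> [B [mB sB]]; exists (fun i => @carrier_val _ _ _ _ A @^-1` B i).
split=> [i|x y xy]; last exact/carrier_val_inj/sB.
by rewrite -[X in measurable X]setTI; exact: measurable_carrier_val.
Qed.

Definition neq_set (T U : Type) (f g : T -> option U) : set T :=
  [set x | f x <> g x].

Section ae_equality.
Context d (T : measurableType d) (E : cber T).
Implicit Types g h : borel_piso E.

Lemma measurable_pdom g : measurable (pdom g).
Proof.
rewrite (_ : pdom g = ppreimage g setT); first exact: piso_ppreimage.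
apply/seteqP; split=> x; rewrite /pdom /=; last by move=> [y _ ->].
by case gx : (g x) => [y|//] _; exists y.
Qed.

Hypothesis sepT : countably_separated T.

(** At a point where both maps are defined, their values differ exactly when
    some member of the separating family contains one value and not the
    other. *)
Lemma measurable_neq_set g h : measurable (neq_set g h).
Proof.
have [B [mB sB]] := sepT.
have mp (k : borel_piso E) i : measurable (ppreimage k (B i)).
  exact: piso_ppreimage.
pose D i := (ppreimage g (B i) `\` ppreimage h (B i)) `|`
            (ppreimage h (B i) `\` ppreimage g (B i)).
rewrite (_ : neq_set g h =
  (pdom g `\` pdom h) `|` (pdom h `\` pdom g) `|` \bigcup_i D i).
  apply: measurableU.
    by apply: measurableU; apply: measurableD; exact: measurable_pdom.
  apply: countable_bigcupT_measurable => // i.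
  by apply: measurableU; apply: measurableD; exact: mp.
apply/seteqP; rewrite /neq_set /pdom; split=> x /=; last first.
  case=> [|[i _ [[[y By gx] nh]|[[y By hx] ng]]] gh].
  - by move=> [] [n /contrapT e] gh; apply: n; rewrite -e.
  - by apply: nh; exists y; rewrite // -gh.
  - by apply: ng; exists y; rewrite // gh.
case gx : (g x) => [y|]; case hx : (h x) => [z|] // yz; last first.
- by left; right; split=> //; apply.
- by left; left; split=> //; apply.
have /existsNP[i /not_implyP[By nBz]] : ~ forall i, B i y -> B i z.
  by move=> /sB yz'; apply: yz; rewrite yz'.
right; exists i => //; left; split; first by exists y.
by move=> [u Bu]; rewrite hx => -[zu]; rewrite zu in nBz.
Qed.

Lemma measurable_fixset g : measurable [set x | g x = Some x].
Proof.
rewrite -[X in measurable X]setCK; apply: measurableC.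
exact: (measurable_neq_set g (piso_id E)).
Qed.

Context (R : realType) (mu : probability T R).

(** Two partial maps differ at a point either because exactly one of them is
    defined there, or because both are and the values differ. *)
Lemma piso_distE g h : piso_dist mu g h = mu (neq_set g h).
Proof.
rewrite /piso_dist -measureU.
- congr (mu _); apply/seteqP; rewrite /neq_set /pdom; split=> x /=.
    by move=> [[]|[]] // [n /contrapT e] gh; apply: n; rewrite -e.
  case gx : (g x) => [y|]; case hx : (h x) => [z|] // yz.
  + by right.
  + by left; left; split=> //; apply.
  + by left; right; split=> //; apply.
- by apply: measurableU; apply: measurableD; exact: measurable_pdom.
- rewrite (_ : [set x | _] = (pdom g `&` pdom h) `&` neq_set g h) //.
  apply: measurableI (measurable_neq_set g h).
  by apply: measurableI; exact: measurable_pdom.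
- by apply/seteqP; split=> // x [[[? nh]|[? ng]] [[]]].
Qed.

Lemma piso_classP g h :
  piso_class mu g = piso_class mu h <-> mu (neq_set g h) = 0%E.
Proof.
have sym (k l : borel_piso E) : neq_set k l = neq_set l k :> set T.
  by apply/seteqP; split=> x /nesym.
have tr (k l m : borel_piso E) : mu (neq_set k l) = 0%E ->
    mu (neq_set l m) = 0%E -> mu (neq_set k m) = 0%E.
  move=> kl lm.
  apply: (@subset_measure0 _ _ _ mu _ (neq_set k l `|` neq_set l m)).
  - exact: measurable_neq_set.
  - by apply: measurableU; exact: measurable_neq_set.
  - move=> x; rewrite /neq_set /= => km.
    by case: (pselect (k x = l x)) => [<-|]; [right|left].
  - by apply: null_set_setU => //; exact: measurable_neq_set.
split=> [[] /seteqP[_ /(_ h)]|gh].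
  rewrite /= !piso_distE; apply.
  by rewrite (_ : neq_set h h = set0) ?measure0//; apply/seteqP; split.
apply: eq_exist; apply/seteqP; split=> k; rewrite /= !piso_distE => H.
  by apply: tr H; rewrite sym.
exact: tr H.
Qed.

Lemma piso_class_ext g h : g =1 h -> piso_class mu g = piso_class mu h.
Proof.
move=> gh; apply/piso_classP; rewrite (_ : neq_set g h = set0) ?measure0//.
by apply/seteqP; split=> // x; rewrite /neq_set /= gh.
Qed.

End ae_equality.

Section class_map.
Context d (T : measurableType d) (R : realType) (mu : probability T R).
Context d' (T' : measurableType d') (mu' : probability T' R).
Variables (E : cber T) (E' : cber T') (phi : borel_piso E -> borel_piso E').

(** The value at a class is computed on a chosen representative, which makes the
    map total whatever [phi] is. *)
Definition class_map (C : full_semigroup mu E) : full_semigroup mu' E' :=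
  piso_class mu' (phi (projT1 (cid (svalP C)))).

Lemma class_mapE : countably_separated T -> countably_separated T' ->
  (forall g h : borel_piso E,
    mu (neq_set g h) = 0%E -> mu' (neq_set (phi g) (phi h)) = 0%E) ->
  forall g, class_map (piso_class mu g) = piso_class mu' (phi g).
Proof.
move=> sT sT' H g; rewrite /class_map; case: cid => h /= gh.
apply/piso_classP => //; apply: H; apply/piso_classP => //.
exact/esym/eq_exist.
Qed.

End class_map.

(** * Models on arbitrary finite sets *)

Definition proportion (R : realType) (F : finType) (P : pred F) : R :=
  #|P|%:R / #|F|%:R.

Lemma proportion_ge0 (R : realType) (F : finType) (P : pred F) :
  0 <= proportion R P.
Proof. by rewrite divr_ge0. Qed.

Lemma proportion_le1 (R : realType) (F : finType) (P : pred F) :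
  proportion R P <= 1.
Proof.
have [F0|F0] := posnP #|F|; first by rewrite /proportion F0 invr0 mulr0.
by rewrite ler_pdivrMr ?ltr0n// mul1r ler_nat max_card.
Qed.

Lemma proportion_subU (R : realType) (F : finType) (P Q S : pred F) :
  (forall x, P x -> Q x || S x) ->
  proportion R P <= proportion R Q + proportion R S.
Proof.
move=> PQS; rewrite -mulrDl ler_wpM2r// -natrD ler_nat.
rewrite -cardUI; apply: leq_trans (leq_addr _ _).
by apply/subset_leq_card/fintype.subsetP => x; exact: PQS.
Qed.

Lemma proportion_sub (R : realType) (F : finType) (P Q : pred F) :
  (forall x, P x -> Q x) -> proportion R P <= proportion R Q.
Proof.
move=> PQ; rewrite ler_wpM2r// ler_nat.
by apply/subset_leq_card/fintype.subsetP => x; exact: PQ.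
Qed.

Lemma eq_proportion (R : realType) (F : finType) (P Q : pred F) :
  P =1 Q -> proportion R P = proportion R Q.
Proof. by move=> PQ; rewrite /proportion (eq_card PQ). Qed.

Lemma pbij_ext N (f g : pbij N) : f =1 g -> f = g.
Proof.
case: f g => f fi [g gi] /= /ffunP fg; rewrite -{}fg in gi *.
by congr PBij; exact: Prop_irrelevance.
Qed.

Lemma pbij_distE (R : realType) N (f g : pbij N) :
  pbij_dist R f g = proportion R [pred x | f x != g x].
Proof.
rewrite /pbij_dist /mu_count /proportion card_ord -mulrDl -natrD.
congr (_%:R / _).
rewrite -[RHS](cardID [pred x | isSome (f x) && isSome (g x)]) addnC.
congr (_ + _)%N; apply: eq_card => x; rewrite !inE.
  by rewrite andbA andbC.
by case: (f x) => [y|]; case: (g x) => [z|].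
Qed.

Lemma card_enum_val (F : finType) (P : pred F) :
  #|[pred i : 'I_#|F| | P (enum_val i)]| = #|P|.
Proof.
rewrite -!sum1_card [RHS](reindex (@enum_val F F)) //.
by apply/onW_bij; exact: enum_val_bij.
Qed.

Lemma proportion_enum_val (R : realType) (F : finType) (P : pred F) :
  proportion R [pred i : 'I_#|F| | P (enum_val i)] = proportion R P.
Proof. by rewrite /proportion card_enum_val card_ord. Qed.

Lemma card_sig_pred (F : finType) (P Q : pred F) :
  #|[pred x : {x | P x} | Q (val x)]| = #|[pred x | P x && Q x]|.
Proof.
rewrite -(fintype.card_image val_inj); apply: eq_card => x; rewrite !inE.
apply/fintype.imageP/andP => [[y Qy ->]|[Px Qx]].
  by split=> //; exact: valP.
by exists (exist _ x Px).
Qed.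

Lemma proportion_sig (R : realType) (F : finType) (P Q : pred F) :
  (0 < #|F|)%N ->
  proportion R [pred x : {x | P x} | Q (val x)] =
  proportion R [pred x | P x && Q x] / proportion R P.
Proof.
move=> F0; rewrite /proportion card_sig_pred card_sig.
by rewrite invf_div mulrA divfK// pnatr_eq0 -lt0n.
Qed.

Lemma card_tagged_pairs (I : finType) (k : I -> nat) (F : I -> finType)
    (P : forall i, pred (F i)) :
  #|[pred x : {i : I & ('I_(k i) * F i)%type} | P (tag x) (tagged x).2]| =
  (\sum_i k i * #|P i|)%N.
Proof.
rewrite -sum1_card.
rewrite -(sig_big_dep predT (fun i (y : 'I_(k i) * F i) => P i y.2)
  (fun _ _ => 1%N)).
apply: eq_bigr => i _.
rewrite -(pair_big predT (P i) (fun _ _ => 1%N)) /=.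
by rewrite sum1_card sum_nat_const card_ord.
Qed.

Lemma card_tagged_prod (I : finType) (k : I -> nat) (F : I -> finType) :
  #|{: {i : I & ('I_(k i) * F i)%type}}| = (\sum_i k i * #|F i|)%N.
Proof.
rewrite card_tagged sumnE big_map big_enum /=.
by apply: eq_bigr => i _; rewrite card_prod card_ord.
Qed.

(** On a disjoint union of [k i] copies of the [F i], a proportion is the
    average of the proportions on the [F i]; the common factor [1 / M] of the
    weights cancels, and serves to make the weights comparable to given
    reals. *)
Lemma proportion_tagged (R : realType) (I : finType) (k : I -> nat)
    (F : I -> finType) (P : forall i, pred (F i)) (M : nat) : (0 < M)%N ->
  (forall i, 0 < #|F i|)%N ->
  let u i : R := (k i * #|F i|)%:R / M%:R in
  proportion R [pred x : {i : I & ('I_(k i) * F i)%type}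
                 | P (tag x) (tagged x).2] =
  (\sum_i u i * proportion R (P i)) / \sum_i u i.
Proof.
move=> M0 F0 u; have M0' : M%:R != 0 :> R by rewrite pnatr_eq0 -lt0n.
rewrite /u -mulr_suml invfM invrK /proportion.
rewrite card_tagged_pairs card_tagged_prod.
rewrite !natr_sum mulrCA [RHS]mulrC; congr (_ * _).
rewrite mulr_suml; apply: eq_bigr => i _.
rewrite !natrM; field.
by rewrite M0' pnatr_eq0 -lt0n F0.
Qed.

Section fintype_models.
Context d (T : measurableType d) (R : realType) (mu : probability T R).
Variable E : cber T.

Let SG := full_semigroup mu E.

(** The approximations of [sofic], with an arbitrary finite set in place of
    ['I_N]: subsets and disjoint unions of finite sets then need no explicit
    numbering. *)
Definition sofic_model (K : set SG) (eps : R) (F : finType)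
    (q : SG -> F -> option F) : Prop :=
  [/\ (0 < #|F|)%N, forall C, partial_injective (q C),
      q (piso_class mu (piso_id E)) =1 Some /\
      q (piso_class mu (piso_empty E)) =1 (fun=> None),
      (forall g h : borel_piso E,
        K (piso_class mu g) -> K (piso_class mu h) ->
        proportion R [pred x | q (piso_class mu (piso_comp g h)) x !=
          pcomp (q (piso_class mu g)) (q (piso_class mu h)) x] < eps)
    & (forall g : borel_piso E, K (piso_class mu g) ->
        `|fine (mu [set x | g x = Some x])
          - proportion R [pred x | q (piso_class mu g) x == Some x]| < eps)].

Lemma sofic_modelP : sofic mu E <->
  forall (K : set SG) (eps : R), finite_set K -> 0 < eps ->
    exists F q, @sofic_model K eps F q.
Proof.
split=> H K eps finK e0; last first.
  have [F [q [F0 qinj [q1 q0] qM qF]]] := H K eps finK e0.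
  pose pf C := [ffun i : 'I_#|F| => omap enum_rank (q C (enum_val i))].
  have pinj C : partial_injective (pf C).
    move=> i j k; rewrite !ffunE.
    case qi : (q C _) => [x|] //= [xk]; case qj : (q C _) => [y|] //= [yk].
    apply/enum_val_inj/(qinj C _ _ x) => //; rewrite qj.
    by congr Some; apply: enum_rank_inj; rewrite xk yk.
  exists #|F|, (fun C => PBij (pinj C)); split=> //.
  - split.
    + apply: pbij_ext => i; rewrite !ffunE q1 /=.
      by rewrite enum_valK.
    + by apply: pbij_ext => i; rewrite !ffunE q0.
  - move=> g h Kg Kh; rewrite pbij_distE; have := qM g h Kg Kh.
    rewrite -proportion_enum_val; congr (_ < _); apply: eq_proportion => i.
    rewrite /= !ffunE /pcomp /= -(inj_eq (inj_omap enum_rank_inj)) ffunE.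
    congr (_ != _); case: (q _ (enum_val i)) => [x|] //=.
    by rewrite ffunE enum_rankK.
  - move=> g Kg; have := qF g Kg.
    rewrite -proportion_enum_val /mu_count /proportion card_ord.
    congr (`|_ - _%:R / _| < _); apply: eq_card => i.
    by rewrite !inE ffunE -(inj_eq (inj_omap enum_rank_inj)) /= enum_valK.
have [N [pi [N0 [p1 p0] pM pF]]] := H K eps finK e0.
exists 'I_N, (fun C x => pi C x); split=> //.
- by rewrite card_ord.
- by move=> C; exact: pbij_inj.
- by rewrite p1 p0; split=> x; rewrite ffunE.
- move=> g h Kg Kh; have := pM g h Kg Kh; rewrite pbij_distE.
  by congr (_ < _); apply: eq_proportion => x; rewrite /= ffunE.
- move=> g Kg; have := pF g Kg; by rewrite /mu_count /proportion card_ord.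
Qed.
End fintype_models.

(** * Extension and restriction of partial isomorphisms *)

Section extension_restriction.
Context d (T : measurableType d) (R : realType) (mu : probability T R).
Variables (E : cber T) (A : nonnull mu).

Let v : carrier A -> T := @carrier_val _ _ _ _ A.
Let iv (x : T) : option (carrier A) := (insub x : option (set_type A)).

Lemma carrier_valK : pcancel v iv.
Proof. exact: valK. Qed.

Lemma insub_carrierP x y : (iv x = Some y) <-> (v y = x).
Proof.
split=> [|<-]; last exact: carrier_valK.
by rewrite /iv; case: insubP => // u _ ux [<-].
Qed.

Lemma carrier_valP (x : carrier A) : nonnull_set A (v x).
Proof. exact: set_mem (valP x). Qed.

Lemma carrier_val_onto x : nonnull_set A x -> exists y : carrier A, v y = x.
Proof. by move=> Ax; exists (exist _ x (mem_set Ax)). Qed.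

Lemma measurable_carrier_preimage (B : set T) :
  measurable B -> measurable (v @^-1` B).
Proof.
by move=> mB; rewrite -[X in measurable X]setTI; exact: measurable_carrier_val.
Qed.

Lemma cond_probE (B : set (carrier A)) :
  cond_prob A B = (mu (v @` B) * ((fine (mu A))^-1)%:E)%E.
Proof. by []. Qed.

Lemma nonnull_mu_gt0 : 0 < fine (mu A).
Proof.
rewrite fine_gt0// lt0e nonnull_neq0 measure_ge0 /=.
by rewrite ltey_eq fin_num_measure//; exact: nonnull_measurable.
Qed.

Lemma fine_cond_prob (B : set (carrier A)) : measurable B ->
  fine (cond_prob A B) = fine (mu (v @` B)) / fine (mu A).
Proof.
move=> mB; rewrite cond_probE fineM//.
by rewrite fin_num_measure//; exact: measurable_carrier_val_image.
Qed.

Lemma cond_prob_eq0 (B : set (carrier A)) :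
  cond_prob A B = 0%E <-> mu (v @` B) = 0%E.
Proof.
rewrite cond_probE; split=> [/eqP|->]; last by rewrite mul0e.
by rewrite mule_eq0 eqe invr_eq0 (gt_eqF nonnull_mu_gt0) orbF => /eqP.
Qed.

Section extension.
Variable g : borel_piso (restr_cber E A).

Definition ext_fun (x : T) : option T := omap v (obind g (iv x)).

Lemma ext_funP x y :
  ext_fun x = Some y <-> exists a b, [/\ v a = x, v b = y & g a = Some b].
Proof.
rewrite /ext_fun; split=> [|[a [b [<- <- gab]]]]; last first.
  by rewrite carrier_valK /= gab.
case xa : (iv x) => [a|] //=; case gab : (g a) => [b|] //= [<-].
by exists a, b; split=> //; apply/insub_carrierP.
Qed.

Lemma ext_inj : partial_injective ext_fun.
Proof.
move=> x y z /ext_funP[a [b [<- <- ga]]] /ext_funP[a' [b' [<- ]]].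
by move=> /carrier_val_inj -> ga'; rewrite (piso_inj ga ga').
Qed.

Lemma ext_rel x y : ext_fun x = Some y -> E x y.
Proof. by move=> /ext_funP[a [b [<- <- /piso_rel]]]. Qed.

Lemma ext_ppreimage (B : set T) :
  measurable B -> measurable (ppreimage ext_fun B).
Proof.
move=> mB; rewrite (_ : ppreimage _ _ = v @` ppreimage g (v @^-1` B)).
  exact/measurable_carrier_val_image/piso_ppreimage/measurable_carrier_preimage.
apply/seteqP.
split=> [x [y By /ext_funP[a [b [<- vb gab]]]]|_ [a [b Bb gab] <-]].
  by exists a => //; exists b; rewrite //= vb.
by exists (v b) => //; apply/ext_funP; exists a, b.
Qed.

Lemma ext_pimage (B : set T) : measurable B -> measurable (pimage ext_fun B).
Proof.
move=> mB; rewrite (_ : pimage _ _ = v @` pimage g (v @^-1` B)).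
  exact/measurable_carrier_val_image/piso_pimage/measurable_carrier_preimage.
apply/seteqP.
split=> [y [x Bx /ext_funP[a [b [va <- gab]]]]|_ [b [a Ba gab] <-]].
  by exists b => //; exists a; rewrite //= va.
by exists (v a) => //; apply/ext_funP; exists a, b.
Qed.

Definition piso_ext : borel_piso E :=
  PartialIso ext_inj ext_rel ext_ppreimage ext_pimage.

End extension.

Section restriction.
Variable g : borel_piso E.

Definition restr_fun (a : carrier A) : option (carrier A) := obind iv (g (v a)).

Lemma restr_funP a b : restr_fun a = Some b <-> g (v a) = Some (v b).
Proof.
rewrite /restr_fun; split=> [|->]; last by rewrite /= carrier_valK.
by case: (g _) => [y|] //= /insub_carrierP <-.
Qed.

Lemma restr_inj : partial_injective restr_fun.
Proof.
by move=> a b c /restr_funP ga /restr_funP /(piso_inj ga)/carrier_val_inj.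
Qed.

Lemma restr_fun_rel a b : restr_fun a = Some b -> restr_cber E A a b.
Proof. by move=> /restr_funP/piso_rel. Qed.

Lemma restr_ppreimage (B : set (carrier A)) :
  measurable B -> measurable (ppreimage restr_fun B).
Proof.
move=> mB; rewrite (_ : ppreimage _ _ = v @^-1` ppreimage g (v @` B)).
  exact/measurable_carrier_preimage/piso_ppreimage/measurable_carrier_val_image.
apply/seteqP; split=> [a [b Bb /restr_funP gab]|a [_ [b Bb <-] gab]].
  by exists (v b) => //; exists b.
by exists b => //; apply/restr_funP.
Qed.

Lemma restr_pimage (B : set (carrier A)) :
  measurable B -> measurable (pimage restr_fun B).
Proof.
move=> mB; rewrite (_ : pimage _ _ = v @^-1` pimage g (v @` B)).
  exact/measurable_carrier_preimage/piso_pimage/measurable_carrier_val_image.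
apply/seteqP; split=> [b [a Ba /restr_funP gab]|b [_ [a Ba <-] gab]].
  by exists (v a) => //; exists a.
by exists a => //; apply/restr_funP.
Qed.

Definition piso_restr : borel_piso (restr_cber E A) :=
  PartialIso restr_inj restr_fun_rel restr_ppreimage restr_pimage.

End restriction.

Lemma piso_ext_empty : piso_ext (piso_empty _) =1 piso_empty E.
Proof. by move=> x; rewrite /= /ext_fun; case: (iv x). Qed.

Lemma piso_ext_comp g h :
  piso_ext (piso_comp g h) =1 piso_comp (piso_ext g) (piso_ext h).
Proof.
move=> x; rewrite /= /ext_fun /pcomp /=; case: (iv x) => //= a.
by rewrite /pcomp; case: (h a) => //= b; rewrite carrier_valK.
Qed.

Lemma piso_ext_id_comp h :
  piso_comp (piso_ext (piso_id _)) (piso_ext h) =1 piso_ext h.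
Proof. 
move=> x; rewrite -piso_ext_comp /= /ext_fun; case: (iv x) => //= a.
by rewrite /pcomp; case: (h a). Qed.

Lemma piso_ext_fix (g : borel_piso (restr_cber E A)) :
  [set x | piso_ext g x = Some x] = v @` [set a | g a = Some a].
Proof.
apply/seteqP; split=> [x /ext_funP[a [b [va vb gab]]]|_ [a ga <-]].
  exists a => //=; rewrite gab; congr Some.
  by apply: carrier_val_inj; rewrite -/v va vb.
by apply/ext_funP; exists a, a.
Qed.

Lemma piso_ext_id_fix :
  [set x | piso_ext (piso_id (restr_cber E A)) x = Some x] = A.
Proof.
rewrite piso_ext_fix; apply/seteqP; split=> [_ [a _ <-]|x Ax].
  exact: carrier_valP.
by have [a <-] := carrier_val_onto Ax; exists a.
Qed.

Lemma piso_ext_neq (g h : borel_piso (restr_cber E A)) :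
  neq_set (piso_ext g) (piso_ext h) = v @` neq_set g h.
Proof.
apply/seteqP; rewrite /neq_set /= /ext_fun; split=> [x|_ [a gh <-]] /=.
  case xa : (iv x) => [a|] //= gh; exists a; last exact/insub_carrierP.
  by move=> e; apply: gh; rewrite e.
by rewrite carrier_valK /= => /(inj_omap (@carrier_val_inj _ _ _ _ _)).
Qed.

Lemma piso_restr_id : piso_restr (piso_id E) =1 piso_id (restr_cber E A).
Proof. by move=> a; exact: carrier_valK. Qed.

Lemma piso_restr_empty :
  piso_restr (piso_empty E) =1 piso_empty (restr_cber E A).
Proof. by []. Qed.

Lemma piso_restr_fix (g : borel_piso E) :
  v @` [set a | piso_restr g a = Some a] = A `&` [set x | g x = Some x].
Proof.
apply/seteqP; split=> [_ [a /restr_funP ga <-]|x [Ax gx]].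
  by split=> //; exact: carrier_valP.
have [a va] := carrier_val_onto Ax; rewrite -va in gx *.
by exists a => //; exact/restr_funP.
Qed.

Lemma piso_restr_neq (g h : borel_piso E) :
  v @` neq_set (piso_restr g) (piso_restr h) `<=` neq_set g h.
Proof.
by move=> _ [a gh <-] e; apply: gh; rewrite /= /restr_fun e.
Qed.

(** Without invariance a point of [A] could be moved out of [A] by [h] and back
    into [A] by [g]. *)
Lemma piso_restr_comp (g h : borel_piso E) : invariant_set E A ->
  piso_restr (piso_comp g h) =1 piso_comp (piso_restr g) (piso_restr h).
Proof.
move=> [S AS] a; rewrite /= /restr_fun /pcomp /= /pcomp.
case ha : (h (v a)) => [y|] //=.
have Ay : nonnull_set A y.
  have := carrier_valP a; rewrite AS => -[s Ss sa].
  by exists s => //; apply: cber_trans sa (piso_rel ha).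
by have [b <-] := carrier_val_onto Ay; rewrite carrier_valK.
Qed.

Lemma class_map_ext : countably_separated T -> forall g,
  class_map mu piso_ext (piso_class (cond_prob A) g) =
  piso_class mu (piso_ext g).
Proof.
move=> sT; apply: class_mapE => //; first exact: carrier_separated.
by move=> g h /cond_prob_eq0; rewrite piso_ext_neq.
Qed.

Lemma class_map_restr : countably_separated T -> forall g,
  class_map (cond_prob A) piso_restr (piso_class mu g) =
  piso_class (cond_prob A) (piso_restr g).
Proof.
move=> sT; apply: class_mapE => //; first exact: carrier_separated.
move=> g h gh; apply/cond_prob_eq0.
apply: subset_measure0 (piso_restr_neq (h := h)) gh.
  by apply/measurable_carrier_val_image/measurable_neq_set/carrier_separated.
exact: measurable_neq_set.
Qed.

End extension_restriction.

(** * Soficity passes to subsets *)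

(** Compares a conditional measure [f / a], with [a = mu A], to a proportion
    [u / t] inside a finite subset of proportion [t]; the hypothesis [u <= t]
    bounds the effect of replacing the denominator [a] by [t]. *)
Lemma ratio_close (R : realType) (a t f u eps delta : R) :
  0 < a -> 0 < t -> 0 <= u <= t -> `|f - u| <= 2 * delta ->
  `|a - t| < delta -> 4 * delta <= eps * a -> `|f / a - u / t| < eps.
Proof.
move=> a0 t0 /andP[u0 ut] fu ta de.
have -> : f / a - u / t = ((f - u) * t - u * (a - t)) / (a * t).
  by field; rewrite !gt_eqF.
have d0 := le_lt_trans (normr_ge0 _) ta.
rewrite normrM normfV [`|a * t|]gtr0_norm ?mulr_gt0// ltr_pdivrMr ?mulr_gt0//.
rewrite (le_lt_trans (ler_normB _ _))// !normrM (gtr0_norm t0) (ger0_norm u0).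
have := ler_wpM2r (ltW t0) fu; have := ler_pM u0 (normr_ge0 _) ut (ltW ta).
have := ler_wpM2r (ltW t0) de; have := mulr_gt0 d0 t0; lra.
Qed.

Section subsets.
Context d (T : measurableType d) (R : realType) (mu : probability T R).
Variable E : cber T.

(** The approximation on [A] is [q], applied to the extensions by [piso_ext] and
    cut down to the fixed points [fixp] of the image [p] of the identity of [A].
    At a point of [fixp] where [q] sends [h] to a value [y] outside [fixp], the
    composite of [p] with [P h] does not take the value [y] again. As [h]
    absorbs the identity of [A], such points are rare. *)
Theorem sofic_restr (A : nonnull mu) : countably_separated T ->
  sofic mu E -> sofic (cond_prob A) (restr_cber E A).
Proof.
move=> sT /sofic_modelP sE; apply/sofic_modelP => K eps finK e0.
pose a := fine (mu A); have a0 : 0 < a := nonnull_mu_gt0 A.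
(* [a / 2] keeps the proportion of fixed points above [a / 2]; [eps * a / 4]
   then beats the two errors of size [delta], divided by that proportion. *)
pose delta := Num.min (a / 2) (eps * a / 4).
have d0 : 0 < delta by rewrite lt_min !divr_gt0// mulr_gt0.
have [da de] : delta <= a / 2 /\ 4 * delta <= eps * a.
  split; first by rewrite ge_min lexx.
  by rewrite mulrC -ler_pdivlMr// ge_min lexx orbT.
pose iota := class_map (mu := cond_prob A) mu (@piso_ext _ _ _ _ E A).
have iotaE (g : borel_piso (restr_cber E A)) :
    iota (piso_class (cond_prob A) g) = piso_class mu (piso_ext g).
  exact: class_map_ext.
pose idA := iota (piso_class _ (piso_id _)).
pose K' := iota @` K `|` [set idA].
have [|F [q [F0 qinj [_ qempty] qM qfix]]] := sE K' _ _ d0.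
  by rewrite finite_setU; split; [exact: finite_image|exact: finite_set1].
have KidA : K' (piso_class mu (piso_ext (piso_id (restr_cber E A)))).
  by right; rewrite -iotaE.
have Kiota (g : borel_piso (restr_cber E A)) : K (piso_class _ g) ->
    K' (piso_class mu (piso_ext g)).
  by move=> Kg; left; exists (piso_class _ g); rewrite ?iotaE.
pose P g := q (piso_class mu (@piso_ext _ _ _ _ E A g)).
pose p := P (piso_id _).
have pP (g : borel_piso (restr_cber E A)) : K (piso_class _ g) ->
    proportion R [pred x | P g x != pcomp p (P g) x] < delta.
  move=> /Kiota Kg; have := qM _ _ KidA Kg.
  by rewrite (piso_class_ext sT mu (@piso_ext_id_comp _ _ _ _ E A g)).
pose fixp := [pred x | p x == Some x].
have fixpa : `|a - proportion R fixp| < delta.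
  by have := qfix _ KidA; rewrite piso_ext_id_fix.
have t0 : 0 < proportion R fixp.
  by move: fixpa; rewrite ltr_distlC => /andP[]; move: da a0; lra.
pose q' C (x : {x | fixp x}) : option {x | fixp x} :=
  obind insub (q (iota C) (val x)).
have q'P C x y : q' C x = Some y <-> q (iota C) (val x) = Some (val y).
  rewrite /q'; split=> [|->]; last by rewrite /= valK.
  by case: (q _ _) => [z|] //=; case: insubP => // u _ <- [<-].
exists {x | fixp x}, q'; split.
- rewrite lt0n; apply: contraTneq t0 => F'0.
  by rewrite /proportion -card_sig F'0 mul0r ltxx.
- by move=> C x y z /q'P xz /q'P yz; apply/val_inj/(qinj _ _ _ _ xz yz).
- split=> x; first by apply/q'P; rewrite iotaE; apply/eqP; exact: (valP x).
  rewrite /q' iotaE (piso_class_ext sT mu (@piso_ext_empty _ _ _ _ E A)).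
  by rewrite qempty.
- move=> g h Kg Kh.
  pose bad := [pred x | (P (piso_comp g h) x != pcomp (P g) (P h) x) ||
                        (P h x != pcomp p (P h) x)].
  apply: (@le_lt_trans _ _
      (proportion R [pred x : {x | fixp x} | bad (val x)])).
    apply: proportion_sub => x; apply: contraR; rewrite /= negb_or !negbK.
    rewrite /q' !iotaE -!/(P _) => /andP[/eqP -> /eqP]; rewrite /pcomp /=.
    case: (P h (val x)) => [y|] //= /esym/eqP py.
    by rewrite (insubT fixp py) /=.
  rewrite proportion_sig // ltr_pdivrMr //.
  have := pP h Kh; have := qM _ _ (Kiota g Kg) (Kiota h Kh).
  rewrite -(piso_class_ext sT mu (piso_ext_comp g h)) => Bgh Bh.
  apply: (@le_lt_trans _ _ (delta + delta)).
    apply: le_trans (lerD (ltW Bgh) (ltW Bh)).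
    by apply: proportion_subU => x /andP[].
  have : eps * (a / 2) < eps * proportion R fixp.
    rewrite ltr_pM2l//; move: fixpa; rewrite ltr_distlC => /andP[].
    by move: da a0; lra.
  by move: de; lra.
- move=> g Kg.
  rewrite fine_cond_prob; last exact/measurable_fixset/carrier_separated.
  rewrite -piso_ext_fix.
  rewrite (@eq_proportion _ _ _ [pred x | P g (val x) == Some (val x)]).
  rewrite (proportion_sig R fixp [pred x | P g x == Some x]) //.
  apply: (ratio_close a0 t0 _ _ fixpa de).
    by rewrite proportion_ge0 proportion_sub // => x /andP[].
  rewrite -[X in `|X|](subrKA (proportion R [pred x | P g x == Some x])).
  rewrite (le_trans (ler_normD _ _)) // mulr_natl mulr2n lerD //.
    exact/ltW/qfix/Kiota.
  rewrite ger0_norm; last by rewrite subr_ge0 proportion_sub// => x /andP[].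
  rewrite lerBlDl; apply: le_trans (lerD (lexx _) (ltW (pP g Kg))).
  apply: proportion_subU => x /eqP Pgx; rewrite /= Pgx /pcomp Pgx /= eqxx andbT.
  by rewrite eq_sym orbN.
- by move=> x; rewrite /= /P -iotaE; apply/eqP/eqP => /q'P.
Qed.

End subsets.

(** * Soficity of a relation with countably many invariant pieces *)

Section disjoint_pieces.
Context d (T : measurableType d) (R : realType) (mu : probability T R).

Lemma fine_muDI (B D : set T) : measurable B -> measurable D ->
  fine (mu D) = fine (mu (D `&` B)) + fine (mu (D `\` B)).
Proof.
move=> mB mD; rewrite (measureDI mu mD mB) addeC fineD//.
  by rewrite fin_num_measure//; exact: measurableI.
by rewrite fin_num_measure//; exact: measurableD.
Qed.

Lemma sum_disjoint_le n (D : 'I_n -> set T) (B : set T) : measurable B ->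
  (forall i, measurable (D i)) -> trivIset setT D -> (forall i, D i `<=` B) ->
  \sum_i fine (mu (D i)) <= fine (mu B).
Proof.
move=> mB mD tD DB; rewrite -lee_fin fineK ?fin_num_measure// -sumEFin.
rewrite (eq_bigr (fun i => mu (D i))); last first.
  by move=> i _; rewrite fineK ?fin_num_measure.
rewrite -measure_bigsetU_ord //; apply: le_measure; rewrite ?inE//.
  exact: bigsetU_measurable.
by apply: (big_ind (fun S => S `<=` B)) => // S S' SB S'B; rewrite subUset.
Qed.

(** The upper bound is the lower bound applied to the complement of [B]. *)
Lemma sum_pieces_bounds n (D : 'I_n -> set T) (B : set T) : measurable B ->
  (forall i, measurable (D i)) -> trivIset setT D ->
  0 <= fine (mu B) - \sum_i fine (mu (D i `&` B)) <=
    1 - \sum_i fine (mu (D i)).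
Proof.
move=> mB mD tD.
have mDB i : measurable (D i `&` B) by exact: measurableI.
have mDC i : measurable (D i `\` B) by exact: measurableD.
have tsub (F : 'I_n -> set T) : (forall i, F i `<=` D i) -> trivIset setT F.
  by move=> FD i j _ _ [x [/FD Di /FD Dj]]; apply: tD => //; exists x.
have lo : \sum_i fine (mu (D i `&` B)) <= fine (mu B).
  by apply: sum_disjoint_le => [||| i x []] //; apply: tsub => i x [].
rewrite subr_ge0 lo /=.
have : \sum_i fine (mu (D i `\` B)) <= fine (mu (~` B)).
  apply: sum_disjoint_le => //; first exact: measurableC.
  by apply: tsub => i x [].
rewrite probability_setC// fineB ?fin_num_measure//=.
under [\sum_i fine (mu (D i))]eq_bigr => i _ do rewrite (fine_muDI mB (mD i)).
by rewrite big_split /=; lra.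
Qed.

(** The measures of the pieces sum to 1, so a finite partial sum exceeds
    [1 - eta]. *)
Lemma exhaust_pieces (I : countType) (A : I -> set T) (eta : R) :
  (forall i, measurable (A i)) -> trivIset setT A -> \bigcup_i A i = setT ->
  0 < eta ->
  exists n (c : 'I_n -> I),
    injective c /\ 1 - eta < \sum_i fine (mu (A (c i))).
Proof.
move=> mA tA cA eta0.
(* The pieces are listed along the enumeration of [I], with empty sets at the
   numbers that encode no index. *)
pose F k := oapp A set0 (@pickle_inv I k).
have mF k : measurable (F k) by rewrite /F; case: pickle_inv => /=.
have tF : trivIset setT F.
  move=> k l _ _; rewrite /F.
  case kE : (pickle_inv k) => [i|] /=; last by rewrite set0I => -[].
  case lE : (pickle_inv l) => [j|] /=; last by rewrite setI0 => -[].
  have := @pickle_invK I k; have := @pickle_invK I l; rewrite kE lE /= => <- <-.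
  by move=> /tA ->.
have UF : \bigcup_k F k = setT.
  apply/seteqP; split=> // x _.
  have [i _ Aix] : (\bigcup_i A i) x by rewrite cA.
  by exists (pickle i) => //; rewrite /F pickleK_inv.
have cvF : (\sum_(0 <= k < n) mu (F k))%E @[n --> \oo] --> 1%E.
  rewrite -(probability_setT mu) -UF; apply: measure_semi_sigma_additive => //.
  by rewrite UF.
have [n nF] : exists n, ((1 - eta)%:E < \sum_(0 <= k < n) mu (F k))%E.
  apply: contrapT => /forallNP H.
  have : (lim ((\sum_(0 <= k < n) mu (F k)) @[n --> \oo]) <= (1 - eta)%:E)%E.
    apply: lime_le; first by apply/cvg_ex; exists 1%E.
    by apply: nearW => n; rewrite leNgt; exact/negP/H.
  by rewrite (cvg_lim _ cvF)// lee_fin; lra.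
pose s := pmap (@pickle_inv I) (iota 0 n).
exists (size s), (tnth (in_tuple s)); split.
  by apply/tuple_uniqP; rewrite /= (pmap_uniq (@pickle_invK I))// iota_uniq.
rewrite -(big_tnth _ _ s predT (fun i => fine (mu (A i)))) big_pmap.
rewrite -lte_fin; apply: (lt_le_trans nF); rewrite -sumEFin /index_iota subn0.
rewrite le_eqVlt; apply/orP; left; apply/eqP; apply: eq_bigr => k _.
rewrite /F; case: pickle_inv => [i|] /=; last by rewrite measure0.
by rewrite fineK ?fin_num_measure.
Qed.

End disjoint_pieces.

(** Rounding down makes [k i * N i] differ from [M * a i] by at most [N i],
    which is negligible against [M] when [M] is large. The weights stay below
    the [a i] and their total is almost that of the [a i]. *)
Lemma integer_weights (R : realType) n (N : 'I_n -> nat) (a : 'I_n -> R)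
    (lambda : R) :
  (forall i, 0 < N i)%N -> (forall i, 0 <= a i) -> lambda < \sum_i a i ->
  exists (k : 'I_n -> nat) (M : nat), [/\ (0 < M)%N,
    forall i, (k i * N i)%:R / M%:R <= a i
    & lambda < \sum_i (k i * N i)%:R / M%:R].
Proof.
move=> N0 a0 la.
pose C : R := \sum_i (N i)%:R.
have C0 : 0 <= C by exact: sumr_ge0.
pose q := (C + 1) / (\sum_i a i - lambda).
have dl : 0 < \sum_i a i - lambda by rewrite subr_gt0.
have q0 : 0 < q by rewrite divr_gt0// ltr_wpDl.
have [M Mq] : exists M : nat, q < M%:R.
  by exists (Num.Def.archi_bound q); exact/archi_boundP/ltW.
have M0 : 0 < M%:R :> R by exact: lt_trans Mq.
pose k i := Num.truncn (M%:R * a i / (N i)%:R).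
have kP i : (k i * N i)%:R <= M%:R * a i < (k i * N i)%:R + (N i)%:R.
  have Ni0 : 0 < (N i)%:R :> R by rewrite ltr0n.
  have /truncn_itv : 0 <= M%:R * a i / (N i)%:R.
    by rewrite divr_ge0// mulr_ge0.
  by rewrite ler_pdivlMr// ltr_pdivrMr// -!natrM -natrD mulSn addnC.
exists k, M; split; first by rewrite -(ltr0n R).
  by move=> i; rewrite ler_pdivrMr// mulrC; have /andP[] := kP i.
rewrite -mulr_suml ltr_pdivlMr//.
have : M%:R * \sum_i a i <= \sum_i (k i * N i)%:R + C.
  rewrite mulr_sumr -big_split /=; apply: ler_sum => i _.
  by have /andP[_ /ltW] := kP i.
move: Mq; rewrite ltr_pdivrMr//.
by lra.
Qed.

(** Here [a i] is the measure of a piece, [f i] the conditional measure of a set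
    in it and [m] the total measure of the set, while [u i] and [q i] are their
    finite counterparts. Since [u i <= a i], all the losses (the mass outside
    the pieces, the rounding of the weights) add up to at most [1 - \sum_i u i]
    from one side; normalizing the weights errs by at most as much from the
    other side, so the two errors do not accumulate. *)
Lemma weighted_average_close (R : realType) (I : finType) (a u f q : I -> R)
    (m eps eta : R) :
  (forall i, 0 <= u i <= a i) -> \sum_i a i <= 1 -> 1 - eta < \sum_i u i ->
  eta <= 1 -> (forall i, 0 <= f i <= 1) -> (forall i, 0 <= q i <= 1) ->
  (forall i, `|f i - q i| <= eps) ->
  0 <= m - \sum_i a i * f i <= 1 - \sum_i a i ->
  `|m - (\sum_i u i * q i) / \sum_i u i| < eps + eta.
Proof.
move=> ua sa su eta1 f01 q01 fq mf.
set U := \sum_i u i in su *; set s := \sum_i a i in sa mf.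
pose uf := \sum_i u i * f i; set uq := \sum_i u i * q i.
have U0 : 0 < U by lra.
have u0 i : 0 <= u i by have /andP[] := ua i.
have Us : U <= s by apply: ler_sum => i _; have /andP[] := ua i.
have muf : 0 <= m - uf <= 1 - U.
  have : 0 <= \sum_i a i * f i - uf <= s - U; last by move: mf; lra.
  rewrite -!sumrB; apply/andP; split.
    apply: sumr_ge0 => i _; rewrite -mulrBl mulr_ge0//.
      by rewrite subr_ge0; have /andP[] := ua i.
    by have /andP[] := f01 i.
  apply: ler_sum => i _; rewrite -mulrBl ler_piMr//.
    by rewrite subr_ge0; have /andP[] := ua i.
  by have /andP[] := f01 i.
have ufq : `|uf - uq| <= U * eps.
  rewrite -sumrB (le_trans (ler_norm_sum _ _ _))// mulr_suml.
  by apply: ler_sum => i _; rewrite -mulrBr normrM ger0_norm// ler_wpM2l.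
have uqU : 0 <= uq <= U.
  rewrite sumr_ge0 => [|i _]; last by rewrite mulr_ge0//; have /andP[] := q01 i.
  by apply: ler_sum => i _; rewrite ler_piMr//; have /andP[] := q01 i.
have Q : 0 <= uq / U <= 1.
  by rewrite divr_ge0 ?ler_pdivrMr ?mul1r ?(ltW U0)//; case/andP: uqU.
have uqE : uq = uq / U * U by rewrite divfK// gt_eqF.
have eps0 : 0 <= U * eps by exact: le_trans ufq.
have Ueps : U * eps <= eps.
  rewrite ler_piMl//; last by lra.
  by move: eps0; rewrite pmulr_rge0.
move: ufq Q; rewrite [uq in `|_ - uq|]uqE; set v := uq / U => ufq Q.
have : v * (1 - U) <= 1 - U by rewrite ler_piMl; lra.
have : 0 <= v * (1 - U) by rewrite mulr_ge0; lra.
by move: ufq; rewrite ler_norml ltr_norml => /andP[??] ??; apply/andP; lra.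
Qed.

Section pieces.
Context d (T : measurableType d) (R : realType) (mu : probability T R).
Variable E : cber T.

(** The finite model is the disjoint union of [k i] copies of the models of
    finitely many pieces, on which a class acts through its restrictions. Every
    copy inherits the multiplicativity estimate, hence so does the union. *)
Theorem sofic_of_invariant_pieces (J : countType) (A : J -> nonnull mu) :
  countably_separated T ->
  trivIset setT (fun i => nonnull_set (A i)) ->
  \bigcup_i nonnull_set (A i) = setT ->
  (forall i, invariant_set E (A i)) ->
  (forall i, sofic (cond_prob (A i)) (restr_cber E (A i))) -> sofic mu E.
Proof.
move=> sT tA cA iA sA; apply/sofic_modelP => K eps finK e0.
have mA i : measurable (A i) by exact: nonnull_measurable.
pose eta := Num.min 1 (eps / 2).
have eta0 : 0 < eta by rewrite lt_min ltr01 divr_gt0.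
have eta1 : eta <= 1 by rewrite ge_min lexx.
have eta2 : eta <= eps / 2 by rewrite ge_min lexx orbT.
have [n [c [cinj sa]]] := exhaust_pieces mu mA tA cA eta0.
pose B i := A (c i).
pose rho i :=
  class_map (mu := mu) (cond_prob (B i)) (@piso_restr _ _ _ _ E (B i)).
have rhoE i (g : borel_piso E) :
    rho i (piso_class mu g) = piso_class (cond_prob (B i)) (piso_restr (B i) g).
  exact: class_map_restr.
have e20 : 0 < eps / 2 by rewrite divr_gt0.
have /fin_all_exists[F /fin_all_exists[q qP]] i :
    exists F q,
      @sofic_model _ _ R _ (restr_cber E (B i)) (rho i @` K) (eps / 2) F q.
  by have /sofic_modelP := sA (c i); apply => //; exact: finite_image.
have F0 i : (0 < #|F i|)%N by have [] := qP i.
have tB : trivIset setT (fun i => nonnull_set (B i)).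
  by move=> i j _ _ /(tA _ _ I I)/cinj.
have a1 : \sum_i fine (mu (B i)) <= 1.
  have := sum_disjoint_le mu (@measurableT _ T) (fun i => mA (c i)) tB.
  by rewrite probability_setT; exact.
have [k [M [M0 ua su]]] := integer_weights F0
  (fun i => ltW (nonnull_mu_gt0 (B i))) sa.
pose u i : R := (k i * #|F i|)%:R / M%:R.
have u0 i : 0 <= u i by rewrite divr_ge0.
have U0 : 0 < \sum_i u i by apply: le_lt_trans su; rewrite subr_ge0.
pose copies i : finType := ('I_(k i) * F i)%type.
pose G : finType := {i : 'I_n & copies i}.
have sB i := carrier_separated (B i) sT.
(* The inclusion of the [l]-th copy of [F i]. *)
pose tau i (l : 'I_(k i)) (y : F i) : G :=
  Tagged copies (l, y).
have tau_inj i l : injective (@tau i l).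
  by move=> y z /(@eq_from_Tagged _ copies i)[].
pose Q C (x : G) : option G :=
  omap (tau (tag x) (tagged x).1) (q (tag x) (rho (tag x) C) (tagged x).2).
have QE C i l x : Q C (@tau i l x) = omap (@tau i l) (q i (rho i C) x) by [].
have KQ i g : K (piso_class mu g) ->
  (rho i @` K) (piso_class _ (piso_restr (B i) g)).
  by move=> Kg; exists (piso_class mu g); rewrite ?rhoE.
exists G, Q; split.
- rewrite card_tagged_prod lt0n; apply: contraTneq U0 => G0.
  by rewrite -mulr_suml -natr_sum G0 mul0r ltxx.
- move=> C [i [l x]] [j [l' y]] z; rewrite /Q /=.
  case xw : (q i _ _) => [w|] //= [<-].
  case yw : (q j _ _) => [w'|] //= /Some_inj e.
  have ij := congr1 tag e; rewrite /= in ij; case: i / ij in l x w xw e *.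
  have [-> ww'] := @eq_from_Tagged _ copies j _ _ e; rewrite ww' in yw.
  by have [_ qinj _ _ _] := qP j; rewrite (qinj _ _ _ _ xw yw).
- split=> -[i [l x]]; rewrite /Q rhoE /=; have [_ _ [q1 q0] _ _] := qP i.
    by rewrite (piso_class_ext (sB i) _ (@piso_restr_id _ _ _ _ E (B i))) q1.
  rewrite (piso_class_ext (sB i) _ (@piso_restr_empty _ _ _ _ E (B i))).
  by rewrite q0.
- move=> g h Kg Kh.
  pose P i (f : borel_piso E) := q i (piso_class _ (piso_restr (B i) f)).
  pose bad i := [pred x | P i (piso_comp g h) x != pcomp (P i g) (P i h) x].
  rewrite (@eq_proportion _ _ _
    [pred x : G | bad (tag x) (tagged x).2]); last first.
    move=> [i [l x]]; rewrite /= QE /= [pcomp (Q _) _ _]/pcomp QE.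
    rewrite /bad /= /pcomp -(inj_eq (inj_omap (@tau_inj i l))) !rhoE.
    rewrite -!/(P _ _); case: (P i h x) => [y|] //=.
    by rewrite QE rhoE.
  rewrite (proportion_tagged R k bad M0 F0) -/u ltr_pdivrMr//.
  apply: (@le_lt_trans _ _ (\sum_i u i * (eps / 2))); last first.
    by rewrite -mulr_suml mulrC ltr_pM2r//; lra.
  apply: ler_sum => i _; rewrite ler_wpM2l// ltW//.
  have [_ _ _ qM _] := qP i; have := qM _ _ (KQ i _ Kg) (KQ i _ Kh).
  by rewrite -(piso_class_ext (sB i) _ (piso_restr_comp _ _ (iA (c i)))).
- move=> g Kg.
  pose fix_ i := [pred x | q i (piso_class _ (piso_restr (B i) g)) x == Some x].
  rewrite (@eq_proportion _ _ _
    [pred x : G | fix_ (tag x) (tagged x).2]); last first.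
    move=> [i [l x]]; rewrite /fix_ /= QE rhoE /=.
    exact: (inj_eq (inj_omap (@tau_inj i l)) _ (Some x)).
  rewrite (proportion_tagged R k fix_ M0 F0) -/u.
  have mg : measurable [set x | g x = Some x] by exact: measurable_fixset.
  have mrg i : measurable [set x | piso_restr (B i) g x = Some x].
    by apply: measurable_fixset; exact: carrier_separated.
  rewrite (lt_le_trans (weighted_average_close (a := fun i => fine (mu (B i)))
    (f := fun i =>
      fine (cond_prob (B i) [set x | piso_restr (B i) g x = Some x]))
    (eps := eps / 2) (eta := eta) _ _ _ _ _ _ _ _))//.
  + by move=> i; rewrite u0 ua.
  + move=> i; rewrite fine_ge0//= -lee_fin fineK ?fin_num_measure//.
    exact: probability_le1.
  + by move=> i; rewrite proportion_ge0 proportion_le1.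
  + move=> i; have [_ _ _ _ qF] := qP i; exact/ltW/qF/KQ.
  + under eq_bigr => i _.
      rewrite fine_cond_prob// piso_restr_fix mulrCA divff ?mulr1; last first.
        by rewrite gt_eqF// nonnull_mu_gt0.
      over.
    pose D i := nonnull_set (B i).
    by apply: (@sum_pieces_bounds _ _ _ mu _ D _ mg) => // i; exact: mA.
  + by rewrite [leRHS]splitr lerD2l.
Qed.
End pieces.

Theorem proposition3p2 (R : realType) (d : measure_display)
    (X : measurableType d) (mu : probability X R) (E : cber X) :
  standard_borel R X -> measure_preserving mu E ->
  (sofic mu E ->
     forall A : nonnull mu, sofic (cond_prob A) (restr_cber E A)) /\
  (forall (I : countType) (A : I -> nonnull mu),
     trivIset [set: I] (fun i => nonnull_set (A i)) ->
     \bigcup_i nonnull_set (A i) = [set: X] ->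
     (forall i, invariant_set E (A i)) ->
     (sofic mu E <->
      forall i, sofic (cond_prob (A i)) (restr_cber E (A i)))).
Proof.
move=> sX _; have sT := standard_borel_separated sX.
split=> [sE A|J A tA cA iA]; first exact: sofic_restr.
by split=> [sE i|]; [exact: sofic_restr|exact: sofic_of_invariant_pieces].
Qed.
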